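(* Let $\Sigma$ be a (simplicial) fan in $\mathbb{R}^n$. The partially ordered set $\mathrm{APart}(\Sigma)$ of admissible partitions of $\Sigma$, ordered by refinement, forms a complete lattice.
   Context: **Fans.** A cone $\sigma\subseteq\mathbb{R}^n$ means a convex polyhedral cone that is strongly convex and simplicial (generated by linearly independent vectors); $\{0\}$ is a cone. A fan $\Sigma$ in $\mathbb{R}^n$ is a collection of such cones, closed under faces, such that the intersection of two cones of $\Sigma$ is a face of each. Let $\mathrm{star}(\sigma)=\{\tau\in\Sigma:\sigma\subseteq\tau\}$, let $\pi_\sigma:\mathbb{R}^n\to\mathrm{span}\{\sigma\}^\perp$ be the orthogonal projection, and $\pi_\sigma(\mathrm{star}(\sigma))=\{\pi_\sigma(\tau):\tau\in\mathrm{star}(\sigma)\}$. **Admissible partitions.** Let $\mathcal{E}_{\sigma_1}=\{\sigma_2\in\Sigma:\mathrm{span}\{\sigma_1\}^\perp=\mathrm{span}\{\sigma_2\}^\perp,\ \pi_{\sigma_1}(\mathrm{star}(\sigma_1))=\pi_{\sigma_2}(\mathrm{star}(\sigma_2))\}$. Consider a partition $\mathfrak{P}$ of $\Sigma$ each of whose blocks is contained in some $\mathcal{E}_\sigma$; write $\sigma_1\sim_{\mathfrak{P}}\sigma_2$ if they lie in the same block. $\mathfrak{P}$ is admissible if whenever $\sigma_1\sim_{\mathfrak{P}}\sigma_2$ and $\tau_i\in\mathrm{star}(\sigma_i)$ satisfy $\pi_{\sigma_1}(\tau_1)=\pi_{\sigma_2}(\tau_2)$, then $\tau_1\sim_{\mathfrak{P}}\tau_2$.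 **Order.** $\mathfrak{P}_1\le\mathfrak{P}_2$ iff $\mathfrak{P}_1$ is finer than $\mathfrak{P}_2$, i.e. $x\sim_{\mathfrak{P}_1}y$ implies $x\sim_{\mathfrak{P}_2}y$. *)

(* Defs.v *)
From HB Require Import structures.
From mathcomp Require Import all_boot all_order all_algebra.
From mathcomp Require Import mathcomp_extra boolp classical_sets reals.

Set Implicit Arguments.
Unset Strict Implicit.
Unset Printing Implicit Defensive.

Import Order.TTheory GRing.Theory Num.Theory.

Local Open Scope classical_set_scope.
Local Open Scope ring_scope.

Definition dot (R : realType) (n : nat) (u v : 'rV[R]_n) : R :=
  \sum_(i < n) u 0 i * v 0 i.

Definition linspan (R : realType) (n : nat) (A : set 'rV[R]_n) : set 'rV[R]_n :=
  \bigcap_(U in [set U : {vspace 'rV[R]_n} | A `<=` [set` U]]) [set` U].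

Definition orth (R : realType) (n : nat) (A : set 'rV[R]_n) : set 'rV[R]_n :=
  [set v | forall u, A u -> dot u v = 0].

(* [xget] picks the unique foot of the perpendicular from [v]; see
   [projP] and [proj_unique] for W = orth (linspan s). *)
Definition orthproj (R : realType) (n : nat) (W : set 'rV[R]_n)
    (v : 'rV[R]_n) : 'rV[R]_n :=
  xget 0 [set w | W w /\ orth W (v - w)].

Definition proj (R : realType) (n : nat) (s : set 'rV[R]_n) :
    'rV[R]_n -> 'rV[R]_n :=
  orthproj (orth (linspan s)).

Definition cone_gen (R : realType) (n : nat) (g : seq 'rV[R]_n) :
    set 'rV[R]_n :=
  [set v | exists2 c : 'I_(size g) -> R,
     forall i, 0 <= c i & v = \sum_(i < size g) c i *: g`_i].

Definition strongly_convex (R : realType) (n : nat) (s : set 'rV[R]_n) : Prop :=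
  forall v, s v -> s (- v) -> v = 0.

Definition is_cone (R : realType) (n : nat) (s : set 'rV[R]_n) : Prop :=
  strongly_convex s /\ exists2 g : seq 'rV[R]_n, free g & s = cone_gen g.

(* The zero functional gives s itself, so faces need not be proper. *)
Definition face (R : realType) (n : nat) (f s : set 'rV[R]_n) : Prop :=
  exists2 m : 'rV[R]_n,
    forall v, s v -> 0 <= dot m v & f = s `&` [set v | dot m v = 0].

Definition is_fan (R : realType) (n : nat) (Sigma : set (set 'rV[R]_n)) : Prop :=
  [/\ forall s, Sigma s -> is_cone s,
      forall s f, Sigma s -> face f s -> Sigma f
    & forall s t, Sigma s -> Sigma t ->
        face (s `&` t) s /\ face (s `&` t) t].

Definition star (R : realType) (n : nat) (Sigma : set (set 'rV[R]_n))
    (s : set 'rV[R]_n) : set (set 'rV[R]_n) :=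
  [set t | Sigma t /\ s `<=` t].

Definition proj_star (R : realType) (n : nat) (Sigma : set (set 'rV[R]_n))
    (s : set 'rV[R]_n) : set (set 'rV[R]_n) :=
  [set proj s @` t | t in star Sigma s].

Definition Eclass (R : realType) (n : nat) (Sigma : set (set 'rV[R]_n))
    (s1 : set 'rV[R]_n) : set (set 'rV[R]_n) :=
  [set s2 | [/\ Sigma s2, orth (linspan s1) = orth (linspan s2)
              & proj_star Sigma s1 = proj_star Sigma s2]].

Definition same_block (T : Type) (P : set (set T)) (x y : T) : Prop :=
  exists2 B : set T, P B & B x /\ B y.

Definition admissible (R : realType) (n : nat) (Sigma : set (set 'rV[R]_n))
    (P : set (set (set 'rV[R]_n))) : Prop :=
  [/\ partition P id Sigma,
      forall B, P B -> exists2 s, Sigma s & B `<=` Eclass Sigma s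
    & forall s1 s2 t1 t2, same_block P s1 s2 ->
        star Sigma s1 t1 -> star Sigma s2 t2 ->
        proj s1 @` t1 = proj s2 @` t2 -> same_block P t1 t2].

Definition APart (R : realType) (n : nat) (Sigma : set (set 'rV[R]_n)) : Type :=
  {P : set (set (set 'rV[R]_n)) | admissible Sigma P}.

Definition refines (T : Type) (P1 P2 : set (set T)) : Prop :=
  forall x y, same_block P1 x y -> same_block P2 x y.

Definition APart_le (R : realType) (n : nat) (Sigma : set (set 'rV[R]_n))
    (P1 P2 : APart Sigma) : bool :=
  `[< refines (sval P1) (sval P2) >].

Lemma partition_refines_sub (T : Type) (S : set T) (P1 P2 : set (set T)) :
  partition P1 id S -> partition P2 id S ->
  refines P1 P2 -> refines P2 P1 -> P1 `<=` P2.
Proof.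
move=> [c1 t1 n1] [c2 t2 n2] r12 r21 B PB.
have [x Bx] := n1 B PB.
have [C PC [Cx _]] := r12 x x (ex_intro2 _ _ B PB (conj Bx Bx)).
suff -> : B = C by [].
apply/seteqP; split=> y.
- move=> By; have [D PD [Dx Dy]] := r12 x y (ex_intro2 _ _ B PB (conj Bx By)).
  by rewrite (t2 C D PC PD _) //; exists x.
- move=> Cy; have [D PD [Dx Dy]] := r21 x y (ex_intro2 _ _ C PC (conj Cx Cy)).
  by rewrite (t1 B D PB PD _) //; exists x.
Qed.

Lemma APart_le_refl (R : realType) (n : nat) (Sigma : set (set 'rV[R]_n)) :
  reflexive (@APart_le R n Sigma).
Proof. by move=> P; apply/asboolP. Qed.

Lemma APart_le_anti (R : realType) (n : nat) (Sigma : set (set 'rV[R]_n)) :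
  antisymmetric (@APart_le R n Sigma).
Proof.
move=> [P hP] [Q hQ] /andP[/asboolP/= PQ /asboolP/= QP].
have [pP _ _] := hP; have [pQ _ _] := hQ.
apply: eq_exist; apply/seteqP; split.
- exact: (partition_refines_sub pP pQ).
- exact: (partition_refines_sub pQ pP).
Qed.

Lemma APart_le_trans (R : realType) (n : nat) (Sigma : set (set 'rV[R]_n)) :
  transitive (@APart_le R n Sigma).
Proof.
move=> Q P S /asboolP PQ /asboolP QS; apply/asboolP => x y Pxy.
exact/QS/PQ.
Qed.

Fact APart_display : Order.disp_t. Proof. exact: Order.Disp tt tt. Qed.

HB.instance Definition _ (R : realType) (n : nat)
    (Sigma : set (set 'rV[R]_n)) := gen_eqMixin (APart Sigma).
HB.instance Definition _ (R : realType) (n : nat)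
    (Sigma : set (set 'rV[R]_n)) := gen_choiceMixin (APart Sigma).
HB.instance Definition _ (R : realType) (n : nat)
    (Sigma : set (set 'rV[R]_n)) :=
  Order.Le_isPOrder.Build APart_display (APart Sigma)
    (@APart_le_refl R n Sigma) (@APart_le_anti R n Sigma)
    (@APart_le_trans R n Sigma).

Definition complete_lattice (d : Order.disp_t) (T : porderType d) : Prop :=
  forall A : set T, supremums A !=set0 /\ infimums A !=set0.

Lemma dotC (R : realType) (n : nat) (u v : 'rV[R]_n) : dot u v = dot v u.
Proof. by apply: eq_bigr => i _; rewrite mulrC. Qed.

Lemma dotDr (R : realType) (n : nat) (u v w : 'rV[R]_n) :
  dot u (v + w) = dot u v + dot u w.
Proof. by rewrite -big_split; apply: eq_bigr => i _; rewrite mxE mulrDr. Qed.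

Lemma dotZr (R : realType) (n : nat) (a : R) (u v : 'rV[R]_n) :
  dot u (a *: v) = a * dot u v.
Proof. by rewrite mulr_sumr; apply: eq_bigr => i _; rewrite mxE mulrCA. Qed.

Lemma dotBr (R : realType) (n : nat) (u v w : 'rV[R]_n) :
  dot u (v - w) = dot u v - dot u w.
Proof. by rewrite dotDr -scaleN1r dotZr mulN1r. Qed.

Lemma dot_eq0 (R : realType) (n : nat) (v : 'rV[R]_n) : dot v v = 0 -> v = 0.
Proof.
move=> /eqP; rewrite psumr_eq0 => [|i _]; last by rewrite -expr2 sqr_ge0.
move=> /allP h; apply/rowP => i; rewrite mxE; apply/eqP.
by have := h i; rewrite mem_index_enum -expr2 sqrf_eq0 /=; apply.
Qed.

Lemma linspan_vspace (R : realType) (n : nat) (A : set 'rV[R]_n) :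
  exists U : {vspace 'rV[R]_n}, linspan A = [set` U].
Proof.
pose p k := `[< exists2 U : {vspace 'rV[R]_n}, A `<=` [set` U] & \dim U = k >].
have exp : exists k, p k.
  exists (\dim (fullv : {vspace 'rV[R]_n})); apply/asboolP; exists fullv => //.
  by move=> v _ /=; rewrite memvf.
case: (ex_minnP exp) => m /asboolP[U AU dU] minU.
exists U; apply/seteqP; split=> [v|v Uv W AW]; first by apply.
have le1 := capvSl U W.
have : (\dim U <= \dim (U :&: W)%VS)%N.
  rewrite dU; apply: minU; apply/asboolP; exists (U :&: W)%VS => // x Ax.
  by rewrite /= memv_cap (AU _ Ax) (AW _ Ax).
move=> /(conj le1)/andP; rewrite -eqEdim => /eqP UW.
by move: Uv; rewrite -UW /= memv_cap => /andP[].
Qed.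

Lemma orth_decomp (R : realType) (n : nat) (g : seq 'rV[R]_n) (v : 'rV[R]_n) :
  exists2 u, u \in <<g>>%VS & forall w, w \in <<g>>%VS -> dot w (v - u) = 0.
Proof.
elim: g v => [|a g IH] v.
  exists 0; first exact: mem0v.
  move=> w; rewrite span_nil memv0 => /eqP ->.
  by rewrite dotC -[X in dot _ X](scale0r v) dotZr mul0r.
have [b gb ab0] := IH a; have [u gu vu0] := IH v.
pose c := dot (a - b) (v - u) / dot (a - b) (a - b).
have sub : (<<g>> <= <<a :: g>>)%VS by rewrite span_cons addvSr.
have aa : a \in <<a :: g>>%VS by apply: memv_span; rewrite mem_head.
exists (u + c *: (a - b)).
  by rewrite memvD ?memvZ ?memvB // (subvP sub).
move=> w; rewrite span_cons => /memv_addP[_ /vlineP[k ->] [y gy ->]].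
have -> : k *: a + y = k *: (a - b) + (k *: b + y).
  by rewrite scalerBr addrA subrK.
have gky : k *: b + y \in <<g>>%VS by rewrite memvD ?memvZ.
have t : dot (a - b) (v - (u + c *: (a - b))) = 0.
  rewrite opprD addrA dotBr dotZr; have [z|nz] := eqVneq (dot (a - b) (a - b)) 0.
    by rewrite z (dot_eq0 z) dotC -(scale0r v) dotZr mul0r mulr0 subr0.
  by rewrite /c divfK // subrr.
rewrite dotC dotDr dotZr dotC t mulr0 add0r dotC opprD addrA dotBr dotZr.
by rewrite (vu0 _ gky) (ab0 _ gky) mulr0 subr0.
Qed.

Lemma projP (R : realType) (n : nat) (s : set 'rV[R]_n) (v : 'rV[R]_n) :
  orth (linspan s) (proj s v) /\ orth (orth (linspan s)) (v - proj s v).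
Proof.
rewrite /proj /orthproj; case: xgetP => [y -> //|none].
have [U sU] := linspan_vspace s.
have [u Uu vu] := orth_decomp (vbasis U) v.
rewrite (span_basis (vbasisP U)) in Uu vu.
case: (none (v - u)); split=> [w|w ow]; first by rewrite sU => /vu.
by rewrite subKr dotC; apply: ow; rewrite sU.
Qed.

Lemma proj_unique (R : realType) (n : nat) (s : set 'rV[R]_n)
    (v w : 'rV[R]_n) :
  orth (linspan s) w -> orth (orth (linspan s)) (v - w) -> w = proj s v.
Proof.
move=> ow ovw; have [op ovp] := projP s v.
apply/eqP; rewrite -subr_eq0; apply/eqP/dot_eq0.
have o : orth (linspan s) (w - proj s v).
  by move=> x sx; rewrite dotBr ow // op // subrr.
have e : w - proj s v = (v - proj s v) - (v - w).
  by rewrite opprB [RHS]addrC addrA subrK.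
by rewrite {2}e dotBr (ovp _ o) (ovw _ o) subrr.
Qed.

(* Main.v *)
Require Import Defs.
From mathcomp Require Import all_boot all_order all_algebra.
From mathcomp Require Import mathcomp_extra boolp classical_sets reals.

(** In a partially ordered set, suprema come for free once every subset has an
infimum, so only infima are constructed.  The infimum of a family [A] of
admissible partitions is the common refinement: [x] and [y] are identified when
every member of [A] identifies them.  Admissibility of each member passes to
this intersection of relations because its premise is inherited by each member
and its conclusion is an intersection again.  The one case that this does not
cover is the empty family, that is, the existence of a coarsest admissible
partition.  That partition is the partition of [Sigma] into the classes
[Eclass]; both cases are treated at once by intersecting [Eclass] with the
relations of the members of [A].

The geometric content is therefore that [Eclass] satisfies the closure
condition of admissibility ([Eclass_star]).  Let [s1] and [s2] be equivalent, so
that they define the same projection [p], and let [t1], [t2] in their stars have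
[p t1 = p t2].  For [s <= t] the space [orth t] is the part of [orth s] that is
orthogonal to [p t], so [t1] and [t2] have the same orthogonal complement, hence
the same projection [q], and [q] factors through [p].  Given [u1] in the star of
[t1], the equivalence of [s1] and [s2] provides [u2] in the star of [s2] with
[p u2 = p u1], and therefore [q u2 = q u1].  What remains is that [u2] contains
[t2].  Since [p t2 <= p u2], this is the fact that inclusions between cones of a
star can be tested after projection ([star_sub_of_proj_sub]): two points with
the same projection along [s] differ by an element of the span of [s], so after
adding suitable elements of [s] they become one point in the intersection of
the two cones, and this intersection is a face. *)

Set Implicit Arguments.
Unset Strict Implicit.
Unset Printing Implicit Defensive.

Import Order.TTheory GRing.Theory Num.Theory.

Local Open Scope classical_set_scope.
Local Open Scope ring_scope.

(* [proj] also names the evaluation of a dependent function at a point. *)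
Local Notation proj := Defs.proj.

(** * Complete lattices and partitions *)

(** A supremum of [A] is an infimum of the set of upper bounds of [A]. *)
Lemma complete_lattice_of_infimums (d : Order.disp_t) (T : porderType d) :
  (forall A : set T, infimums A !=set0) -> complete_lattice T.
Proof.
move=> inf A; split; last exact: inf.
have [x [lbx glbx]] := inf (ubound A).
exists x; split=> // a Aa; apply: glbx => u; exact.
Qed.

Lemma same_block_sym (T : Type) (P : set (set T)) (x y : T) :
  same_block P x y -> same_block P y x.
Proof. by move=> [B PB [Bx By]]; exists B. Qed.

Section PartitionRelation.
Variables (T : Type) (S : set T).

Lemma same_block_refl (P : set (set T)) (x : T) :
  partition P id S -> S x -> same_block P x x.
Proof. by move=> [<- _ _] [B PB Bx]; exists B. Qed.

Lemma same_block_trans (P : set (set T)) (x y z : T) :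
  partition P id S -> same_block P x y -> same_block P y z ->
  same_block P x z.
Proof.
move=> [_ tr _] [B PB [Bx By]] [C PC [Cy Cz]].
have BC : B = C by apply: tr => //; exists y.
by exists B => //; split=> //; rewrite BC.
Qed.

Lemma same_block_mem (P : set (set T)) (x y : T) :
  partition P id S -> same_block P x y -> S x /\ S y.
Proof. by move=> [<- _ _] [B PB [Bx By]]; split; exists B. Qed.

Definition quotient_blocks (r : T -> T -> Prop) : set (set T) :=
  [set [set y | S y /\ r x y] | x in S].

Variable r : T -> T -> Prop.
Hypothesis rxx : forall x, S x -> r x x.
Hypothesis rsym : forall x y, S x -> S y -> r x y -> r y x.
Hypothesis rtrans : forall x y z,
  S x -> S y -> S z -> r x y -> r y z -> r x z.

Lemma partition_quotient_blocks : partition (quotient_blocks r) id S.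
Proof.
split.
- apply/seteqP; split=> [y [_ [x Sx <-] []] //|x Sx].
  by exists [set y | S y /\ r x y]; [exists x|split=> //; exact: rxx].
- move=> _ _ [x Sx <-] [y Sy <-] [z [[Sz xz] [_ yz]]].
  have xy : r x y by apply: (rtrans Sx Sz Sy xz); apply: rsym.
  apply/seteqP; split=> w [Sw rw]; split=> //.
    by apply: (rtrans Sy Sx Sw _ rw); apply: rsym.
  exact: (rtrans Sx Sy Sw xy).
- by move=> _ [x Sx <-]; exists x; split=> //; exact: rxx.
Qed.

Lemma same_block_quotient (x y : T) :
  same_block (quotient_blocks r) x y <-> [/\ S x, S y & r x y].
Proof.
split=> [[_ [z Sz <-] [[Sx zx] [Sy zy]]]|[Sx Sy xy]].
  by split=> //; apply: (rtrans Sx Sz Sy _ zy); apply: rsym.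
exists [set z | S z /\ r x z]; first by exists x.
by do !split=> //; exact: rxx.
Qed.

End PartitionRelation.

(** * Orthogonal projections along cones *)

Section Geometry.
Variables (R : realType) (n : nat).
Implicit Types (s t u : set 'rV[R]_n) (v w x y : 'rV[R]_n).

(** The vectors orthogonal to a given [v] form a subspace, the kernel of the
scalar product with [v]; if it contains [s], it contains the span of [s]. *)
Lemma orth_linspan s : orth (linspan s) = orth s.
Proof.
apply/seteqP; split=> v ov w sw.
  by apply: ov => U; apply.
have ker w' : (w' \in lker (linfun (mulmxr v^T))) = (dot w' v == 0).
  rewrite memv_ker lfunE /=; apply/eqP/eqP => [/matrixP/(_ 0 0)|d0].
    rewrite !mxE => e; rewrite -[RHS]e.
    by apply: eq_bigr => i _; rewrite mxE.
  apply/matrixP => i j; rewrite !ord1 !mxE -[RHS]d0.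
  by apply: eq_bigr => k _; rewrite mxE.
have /= := sw (lker (linfun (mulmxr v^T))); rewrite ker => h.
by apply/eqP/h => x sx /=; rewrite ker; apply/eqP/ov.
Qed.

Lemma orthS s t : s `<=` t -> orth t `<=` orth s.
Proof. by move=> st v tv w /st; exact: tv. Qed.

Lemma proj_orth s v : orth s (proj s v).
Proof. by have [] := projP s v; rewrite orth_linspan. Qed.

Lemma sub_proj_orth s v : orth (orth s) (v - proj s v).
Proof. by have [_] := projP s v; rewrite orth_linspan. Qed.

Lemma orthD s v w : orth s v -> orth s w -> orth s (v + w).
Proof. by move=> ov ow x sx; rewrite dotDr ov // ow // addr0. Qed.

Lemma orthN s v : orth s v -> orth s (- v).
Proof. by move=> ov x sx; rewrite -scaleN1r dotZr ov // mulr0. Qed.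

Lemma eq_proj s t : orth (linspan s) = orth (linspan t) -> proj s = proj t.
Proof. by rewrite /Defs.proj => ->. Qed.

(** For [v] in [orth s] the scalar products with [x] and with [proj s x] agree,
because [x - proj s x] is orthogonal to [orth s]. *)
Lemma orth_supset s t : s `<=` t -> orth t = orth s `&` orth (proj s @` t).
Proof.
move=> st.
have dotp v x : orth s v -> dot (proj s x) v = dot x v.
  move=> sv; have := sub_proj_orth (s := s) x sv.
  by rewrite dotBr => /eqP; rewrite subr_eq0 !(dotC v) => /eqP ->.
apply/seteqP; split=> [v tv|v [sv pv] x tx].
  have sv := orthS st tv.
  by split=> // _ [x tx <-]; rewrite dotp //; exact: tv.
by rewrite -(dotp _ _ sv); apply: pv; exists x.
Qed.

Lemma proj_proj s t : s `<=` t -> proj t \o proj s = proj t.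
Proof.
move=> st; apply/funext => x /=; apply/esym/proj_unique.
  by rewrite orth_linspan; exact: proj_orth.
rewrite orth_linspan.
have -> : proj s x - proj t x = (x - proj t x) - (x - proj s x).
  by rewrite opprB [RHS]addrC addrA subrK.
apply: orthD; first exact: sub_proj_orth.
apply/orthN/(@orthS _ (orth s)); last exact: sub_proj_orth.
exact: orthS.
Qed.

Lemma cone_genD (g : seq 'rV[R]_n) v w :
  cone_gen g v -> cone_gen g w -> cone_gen g (v + w).
Proof.
move=> [a a0 ->] [b b0 ->]; exists (fun i => a i + b i).
  by move=> i; rewrite addr_ge0.
by rewrite -big_split; apply: eq_bigr => i _; rewrite scalerDl.
Qed.

Lemma isconeD s v w : is_cone s -> s v -> s w -> s (v + w).
Proof. by move=> [_ [g _ ->]]; exact: cone_genD. Qed.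

(** A vector of the span is a difference of two vectors of the cone: separate
the positive from the negative coefficients. *)
Lemma span_cone_gen (g : seq 'rV[R]_n) v : v \in <<g>>%VS ->
  exists a b, [/\ cone_gen g a, cone_gen g b & v + a = b].
Proof.
move=> gv; pose c i := coord (in_tuple g) i v.
have cv : v = \sum_(i < size g) c i *: g`_i.
  exact: (coord_span (X := in_tuple g) gv).
exists (\sum_(i < size g) (`|c i| - c i) *: g`_i).
exists (\sum_(i < size g) `|c i| *: g`_i); split.
- by exists (fun i => `|c i| - c i) => // i; rewrite subr_ge0 ler_norm.
- by exists (fun i => `|c i|).
- rewrite [in LHS]cv -big_split; apply: eq_bigr => i _ /=.
  by rewrite -scalerDl addrC subrK.
Qed.

(** By the orthogonal decomposition along the generators, the double orthogonal
complement of a cone lies in its span. *)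
Lemma orth_orth_span (g : seq 'rV[R]_n) v :
  orth (orth (cone_gen g)) v -> v \in <<g>>%VS.
Proof.
move=> oov; have [u gu ug] := orth_decomp g v.
have ou : orth (cone_gen g) (v - u).
  move=> _ [c _ ->]; apply: ug; apply: memv_suml => i _.
  by apply/memvZ/memv_span/mem_nth.
suff /eqP : v - u = 0 by rewrite subr_eq0 => /eqP ->.
by apply: dot_eq0; rewrite dotBr (oov _ ou) dotC ug // subr0.
Qed.

Lemma eq_proj_cone s x y : is_cone s -> proj s x = proj s y ->
  exists a b, [/\ s a, s b & x + a = y + b].
Proof.
move=> [_ [g _ ->]] pxy.
have oo : orth (orth (cone_gen g)) (x - y).
  have -> : x - y = (x - proj (cone_gen g) x) - (y - proj (cone_gen g) y).
    by rewrite pxy opprB addrA subrK.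
  by apply: orthD; [|apply: orthN]; exact: sub_proj_orth.
have [a [b [ga gb e]]] := span_cone_gen (orth_orth_span oo).
by exists a, b; split=> //; rewrite -e addrA [y + _]addrC subrK.
Qed.

(** * The coarsest admissible partition *)

Variable Sigma : set (set 'rV[R]_n).
Hypothesis fan : is_fan Sigma.

(** If [x] in [t] projects to the same point as [y] in [u], then
[x + a = y + b] with [a], [b] in [s], and this point lies in the face
[t `&` u] of [t]; a sum of two points of a cone can only lie in a face if both
summands do. *)
Lemma star_sub_of_proj_sub s t u : Sigma s -> star Sigma s t ->
  star Sigma s u -> proj s @` t `<=` proj s @` u -> t `<=` u.
Proof.
have [cones _ faces] := fan; move=> Ss [St st] [Su su] ptu x tx.
have [y uy pyx] := ptu _ (ex_intro2 _ _ x tx erefl).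
have [a [b [sa sb e]]] := eq_proj_cone (cones _ Ss) (esym pyx).
have [[m m_ge0 tuE] _] := faces _ _ St Su.
have : (t `&` u) (x + a).
  split; first exact: isconeD (cones _ St) tx (st _ sa).
  by rewrite e; exact: isconeD (cones _ Su) uy (su _ sb).
rewrite tuE => -[_ /= /eqP]; rewrite dotDr.
rewrite paddr_eq0 ?m_ge0 //; last exact: st.
move=> /andP[/eqP mx _].
have : (t `&` [set v | dot m v = 0]) x by [].
by rewrite -tuE => -[].
Qed.

Lemma Eclass_sym s t : Sigma s -> Eclass Sigma s t -> Eclass Sigma t s.
Proof. by move=> Ss [_ o p]; split. Qed.

Lemma Eclass_trans s t u :
  Eclass Sigma s t -> Eclass Sigma t u -> Eclass Sigma s u.
Proof. by move=> [_ o p] [Su o' p']; split; rewrite // ?o ?p. Qed.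

Lemma proj_star_sub s1 s2 t1 t2 :
  Eclass Sigma s1 s2 -> star Sigma s1 t1 -> star Sigma s2 t2 ->
  proj s1 @` t1 = proj s2 @` t2 -> proj t1 = proj t2 ->
  proj_star Sigma t1 `<=` proj_star Sigma t2.
Proof.
move=> [Ss2 os ps] [St1 st1] [St2 st2] pt qt _ [u1 [Su1 tu1] <-].
have [u2 [Su2 su2] pu] : proj_star Sigma s2 (proj s1 @` u1).
  by rewrite -ps; exists u1 => //; split=> //; exact: subset_trans tu1.
exists u2; last first.
  by rewrite -(proj_proj st2) -image_comp pu -qt image_comp proj_proj.
split=> //; apply: (star_sub_of_proj_sub Ss2); [by []|by []|].
by rewrite pu -pt; exact: image_subset.
Qed.

Lemma Eclass_star s1 s2 t1 t2 : Sigma s1 ->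
  Eclass Sigma s1 s2 -> star Sigma s1 t1 -> star Sigma s2 t2 ->
  proj s1 @` t1 = proj s2 @` t2 -> Eclass Sigma t1 t2.
Proof.
move=> Ss1 E12 st1 st2 pt.
have ot : orth (linspan t1) = orth (linspan t2).
  have [_] := E12; rewrite !orth_linspan => os _.
  by rewrite (orth_supset st1.2) (orth_supset st2.2) os pt.
have qt := eq_proj ot.
split=> //; first by case: st2.
apply/seteqP; split; first exact: proj_star_sub E12 st1 st2 pt qt.
exact: proj_star_sub (Eclass_sym Ss1 E12) st2 st1 (esym pt) (esym qt).
Qed.

(** * Common refinements *)

(** The conjunct [Eclass] makes the empty family yield the coarsest admissible
partition. *)
Definition common_rel (A : set (APart Sigma)) s t : Prop :=
  Eclass Sigma s t /\ forall P, A P -> same_block (sval P) s t.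

Lemma APart_partition (P : APart Sigma) : partition (sval P) id Sigma.
Proof. by case: P => P []. Qed.

Lemma APart_Eclass (P : APart Sigma) s t :
  same_block (sval P) s t -> Eclass Sigma s t.
Proof.
case: P => P [/= _ sub _] [B /sub[u Su BE] [/BE us /BE ut]].
exact: Eclass_trans (Eclass_sym Su us) ut.
Qed.

Lemma common_rel_refl (A : set (APart Sigma)) s : Sigma s -> common_rel A s s.
Proof.
move=> Ss; split=> // P _; exact: same_block_refl (APart_partition P) Ss.
Qed.

Lemma common_rel_sym (A : set (APart Sigma)) s t :
  Sigma s -> Sigma t -> common_rel A s t -> common_rel A t s.
Proof.
move=> Ss _ [E r]; split; first exact: Eclass_sym.
by move=> P /r; exact: same_block_sym.
Qed.

Lemma common_rel_trans (A : set (APart Sigma)) s t u : Sigma s -> Sigma t -> Sigma u ->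
  common_rel A s t -> common_rel A t u -> common_rel A s u.
Proof.
move=> _ _ _ [E1 r1] [E2 r2]; split; first exact: Eclass_trans E2.
move=> P AP; apply: same_block_trans (APart_partition P) (r1 P AP) (r2 P AP).
Qed.

Lemma same_block_common (A : set (APart Sigma)) s t :
  same_block (quotient_blocks Sigma (common_rel A)) s t <->
  [/\ Sigma s, Sigma t & common_rel A s t].
Proof.
exact: same_block_quotient (@common_rel_refl A) (@common_rel_sym A)
  (@common_rel_trans A) s t.
Qed.

Lemma admissible_common (A : set (APart Sigma)) :
  admissible Sigma (quotient_blocks Sigma (common_rel A)).
Proof.
split.
- exact: partition_quotient_blocks (@common_rel_refl A) (@common_rel_sym A)
    (@common_rel_trans A).
- by move=> _ [s Ss <-]; exists s => // t [_ []].
move=> s1 s2 t1 t2 /same_block_common[Ss1 _ [E r]] st1 st2 pt.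
apply/same_block_common; split; [by case: st1|by case: st2|].
split; first exact: Eclass_star E st1 st2 pt.
move=> P AP; have [_ _ closed] := svalP P.
exact: closed (r P AP) st1 st2 pt.
Qed.

Lemma infimums_APart (A : set (APart Sigma)) : infimums A !=set0.
Proof.
exists (exist _ _ (admissible_common A)); split.
  move=> P AP; apply/asboolP => s t /same_block_common[_ _ [_]]; exact.
move=> Q lbQ; apply/asboolP => s t Qst; apply/same_block_common.
have [Ss St] := same_block_mem (APart_partition Q) Qst.
split=> //; split; first exact: APart_Eclass Qst.
by move=> P /lbQ/asboolP; exact.
Qed.

End Geometry.

Theorem proposition5p2 (R : realType) (n : nat) (Sigma : set (set 'rV[R]_n))
    (hSigma : is_fan Sigma) :
  complete_lattice (APart Sigma).
Proof.
exact: complete_lattice_of_infimums (infimums_APart hSigma).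
Qed.
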